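(* Let $k$ be a commutative ring and let $\mathcal C$ be a cooperad with comultiplication in $k$-modules. Define the cup coproduct $\cup^c\colon\mathcal C(n)\to\bigoplus_{j=1}^{n+1}\mathcal C(j-1)\otimes\mathcal C(n+1-j)$ by $$\cup^c x:=\sum_{j=1}^{n+1}(\mu^c\otimes\mathrm{id}^{\otimes2})\circ(\Delta_{2,j-1,1}\otimes\mathrm{id})\circ\Delta_{j,n+1-j,j}(x),\qquad x\in\mathcal C(n),$$ and define $\overline e^c\colon\mathcal C\to k$ by $\overline e^c(x)=e^c(x)$ for $x\in\mathcal C(0)$ and $\overline e^c(x)=0$ for $x\in\mathcal C(n)$, $n>0$. Let $d$ be the differential of $\mathcal C$ recalled in the context. Then $(\mathcal C,\cup^c,d,\overline e^c)$, with $\mathcal C(n)$ in degree $n$, is a dg coassociative counital coalgebra. That is, $(\cup^c\otimes\mathrm{id})\circ\cup^c=(\mathrm{id}\otimes\cup^c)\circ\cup^c$, $(\overline e^c\otimes\mathrm{id})\circ\cup^c=\mathrm{id}=(\mathrm{id}\otimes\overline e^c)\circ\cup^c$, and $\cup^c\circ d=\big(d\otimes\mathrm{id}+\tau\circ(d\otimes\mathrm{id})\circ\tau\big)\circ\cup^c$, where $\tau(a\otimes b)=(-1)^{|a||b|}b\otimes a$.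
   Context: Tensor products are over $k$, and $k\otimes M\cong M\cong M\otimes k$ is used implicitly. A planar counital cooperad is a sequence $\mathcal C=\{\mathcal C(n)\}_{n\ge0}$ of $k$-modules with $k$-linear maps $\epsilon\colon\mathcal C(1)\to k$ and $\Delta_{p,q,i}\colon\mathcal C(p+q-1)\to\mathcal C(p)\otimes\mathcal C(q)$ for $p\ge1$, $q\ge0$, $1\le i\le p$ (and $\Delta_{0,q,i}:=0$), such that $(\epsilon\otimes\mathrm{id})\circ\Delta_{1,n,1}=\mathrm{id}_{\mathcal C(n)}$, $(\mathrm{id}\otimes\epsilon)\circ\Delta_{n,1,i}=\mathrm{id}_{\mathcal C(n)}$ for $1\le i\le n$, and for all $p\ge 1$, $q,r\ge0$, $1\le i\le p$, $1\le j\le p+q-1$: $$(\Delta_{p,q,i}\otimes\mathrm{id})\circ\Delta_{p+q-1,r,j}=\begin{cases}(\mathrm{id}\otimes\sigma)\circ(\Delta_{p,r,j-q+1}\otimes\mathrm{id})\circ\Delta_{p+r-1,q,i}& i\le j-q,\\(\mathrm{id}\otimes\Delta_{q,r,j-i+1})\circ\Delta_{p,q+r-1,i}& j-q<i\le j,\\(\mathrm{id}\otimes\sigma)\circ(\Delta_{p,r,j}\otimes\mathrm{id})\circ\Delta_{p+r-1,q,i+r-1}& j<i\le p,\end{cases}$$ where $\sigma(a\otimes b)=b\otimes a$. A cooperad with comultiplication is a planar counital cooperad $\mathcal C$ with a morphism of counital cooperads to the linear dual of the unital associative operad; equivalently, with $k$-linear maps $\mu^c\colon\mathcal C(2)\to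 k$ and $e^c\colon\mathcal C(0)\to k$ such that $(\mu^c\otimes\mu^c)\circ\Delta_{2,2,1}=(\mu^c\otimes\mu^c)\circ\Delta_{2,2,2}$ and $(\mu^c\otimes e^c)\circ\Delta_{2,0,1}=(\mu^c\otimes e^c)\circ\Delta_{2,0,2}=\epsilon$. Differential: on $\mathcal C(n)$, $n\geq 1$, $d=(\mu^c\otimes\mathrm{id})\circ\big(\Delta_{2,n-1,2}+(-1)^n\Delta_{2,n-1,1}\big)+\sum_{i=1}^{n-1}(-1)^i(\mathrm{id}\otimes\mu^c)\circ\Delta_{n-1,2,i}\colon\mathcal C(n)\to\mathcal C(n-1)$ and $d=0$ on $\mathcal C(0)$. *)

(* Defs.v *)
From HB Require Import structures.
From mathcomp Require Import all_boot all_order all_algebra.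
From mathcomp Require Import boolp.

Set Implicit Arguments.
Unset Strict Implicit.
Unset Printing Implicit Defensive.

Import GRing.Theory.
Local Open Scope ring_scope.
Local Open Scope quotient_scope.

(** * Tensor products of modules over a commutative ring *)

(* MathComp's own bilinearity predicate needs a nontrivial ring of scalars. *)
Definition is_bilinear (k : comPzRingType) (M N P : lmodType k)
    (f : M -> N -> P) : Prop :=
  (forall y, linear (f^~ y)) /\ (forall x, linear (f x)).

(* The list [:: (x1, y1); ...; (xr, yr)] stands for the sum of the pure tensors
   xi (x) yi; [tensor_rel] is the congruence generated by the bilinearity
   relations. *)
Inductive tensor_rel (k : comPzRingType) (M N : lmodType k) :
    seq (M * N) -> seq (M * N) -> Prop :=
| TensorRefl s : tensor_rel s s
| TensorSym s t : tensor_rel s t -> tensor_rel t s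
| TensorTrans s t u : tensor_rel s t -> tensor_rel t u -> tensor_rel s u
| TensorCat s s' t t' :
    tensor_rel s s' -> tensor_rel t t' -> tensor_rel (s ++ t) (s' ++ t')
| TensorCatC s t : tensor_rel (s ++ t) (t ++ s)
| TensorZero y : tensor_rel [:: (0, y)] [::]
| TensorAddl x x' y : tensor_rel [:: (x + x', y)] [:: (x, y); (x', y)]
| TensorAddr x y y' : tensor_rel [:: (x, y + y')] [:: (x, y); (x, y')]
| TensorScale a x y : tensor_rel [:: (a *: x, y)] [:: (x, a *: y)].

Section Tensor.
Variables (k : comPzRingType) (M N : lmodType k).

Definition tensor_relb (s t : seq (M * N)) : bool := `[< tensor_rel s t >].

Lemma tensor_relb_refl : reflexive tensor_relb.
Proof. by move=> s; apply/asboolP/TensorRefl. Qed.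

Lemma tensor_relb_sym : symmetric tensor_relb.
Proof. by move=> s t; apply/asboolP/asboolP; apply: TensorSym. Qed.

Lemma tensor_relb_trans : transitive tensor_relb.
Proof.
by move=> t s u /asboolP st /asboolP tu; apply/asboolP/(TensorTrans st tu).
Qed.

Canonical tensor_equiv :=
  EquivRel tensor_relb tensor_relb_refl tensor_relb_sym tensor_relb_trans.

Definition tensor : Type := {eq_quot tensor_equiv}.

HB.instance Definition _ := Choice.on tensor.
HB.instance Definition _ : EqQuotient _ tensor_equiv tensor :=
  EqQuotient.on tensor.

Definition tensor_of_seq (s : seq (M * N)) : tensor := \pi_tensor s.

Definition pure (x : M) (y : N) : tensor := tensor_of_seq [:: (x, y)].

Lemma tensor_of_seqP s t : tensor_of_seq s = tensor_of_seq t <-> tensor_rel s t.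
Proof. by split => [/eqmodP/asboolP|st]; last exact/eqmodP/asboolP. Qed.

Lemma tensor_reprK (t : tensor) : tensor_of_seq (repr t) = t.
Proof. exact: reprK. Qed.

Lemma tensor_repr_rel (s : seq (M * N)) : tensor_rel (repr (tensor_of_seq s)) s.
Proof. by apply/tensor_of_seqP; rewrite tensor_reprK. Qed.

Definition tensor_add (t u : tensor) : tensor :=
  tensor_of_seq (repr t ++ repr u).

Definition tensor_scale (a : k) (t : tensor) : tensor :=
  tensor_of_seq [seq (a *: p.1, p.2) | p <- repr t].

Definition tensor_opp (t : tensor) : tensor := tensor_scale (- 1) t.

Let seq_add s t :
  tensor_add (tensor_of_seq s) (tensor_of_seq t) = tensor_of_seq (s ++ t).
Proof. by apply/tensor_of_seqP; apply: TensorCat; apply: tensor_repr_rel. Qed.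

Let scale_rel a (s t : seq (M * N)) : tensor_rel s t ->
  tensor_rel [seq (a *: p.1, p.2) | p <- s] [seq (a *: p.1, p.2) | p <- t].
Proof.
elim=> {s t} /=.
- by move=> s; apply: TensorRefl.
- by move=> s t _; apply: TensorSym.
- by move=> s t u _ st _ tu; apply: TensorTrans st tu.
- by move=> s s' t t' _ ss' _ tt'; rewrite !map_cat; apply: TensorCat.
- by move=> s t; rewrite !map_cat; apply: TensorCatC.
- by move=> y; rewrite scaler0; apply: TensorZero.
- by move=> x x' y; rewrite scalerDr; apply: TensorAddl.
- by move=> x y y'; apply: TensorAddr.
- by move=> b x y; rewrite scalerA mulrC -scalerA; apply: TensorScale.
Qed.

Let seq_scale a s : tensor_scale a (tensor_of_seq s) =
  tensor_of_seq [seq (a *: p.1, p.2) | p <- s].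
Proof. exact/tensor_of_seqP/scale_rel/tensor_repr_rel. Qed.

Let tensorW (P : tensor -> Prop) :
  (forall s, P (tensor_of_seq s)) -> forall t, P t.
Proof. by move=> PT t; rewrite -(tensor_reprK t). Qed.

Let tensor_addA : associative tensor_add.
Proof.
elim/tensorW=> s; elim/tensorW=> t; elim/tensorW=> u.
by rewrite !seq_add catA.
Qed.

Let tensor_addC : commutative tensor_add.
Proof.
elim/tensorW=> s; elim/tensorW=> t; rewrite !seq_add.
exact/tensor_of_seqP/TensorCatC.
Qed.

Let tensor_add0 : left_id (tensor_of_seq [::]) tensor_add.
Proof. by elim/tensorW=> s; rewrite seq_add. Qed.

Let scaleDl t a b :
  tensor_scale (a + b) t = tensor_add (tensor_scale a t) (tensor_scale b t).
Proof.
elim/tensorW: t => s; rewrite !seq_scale seq_add; apply/tensor_of_seqP.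
elim: s => [|[x y] s IHs] /=; first exact: TensorRefl.
rewrite -cat1s; apply: (@TensorTrans _ _ _ _
  ([:: (a *: x, y); (b *: x, y)] ++
   ([seq (a *: p.1, p.2) | p <- s] ++ [seq (b *: p.1, p.2) | p <- s]))).
  by apply: TensorCat IHs; rewrite scalerDl; apply: TensorAddl.
set sa := [seq _ | p <- s]; set sb := [seq _ | p <- s].
apply: (@TensorCat _ _ _ [:: (a *: x, y)] [:: (a *: x, y)]
  ((b *: x, y) :: sa ++ sb) (sa ++ (b *: x, y) :: sb)).
  exact: TensorRefl.
rewrite -cat1s catA -[(b *: x, y) :: sb]cat1s catA.
by apply: TensorCat; [apply: TensorCatC | apply: TensorRefl].
Qed.

Let scale0 t : tensor_scale 0 t = tensor_of_seq [::].
Proof.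
elim/tensorW: t => s; rewrite seq_scale; apply/tensor_of_seqP.
elim: s => [|[x y] s IHs] /=; first exact: TensorRefl.
rewrite -cat1s -[X in tensor_rel _ X]cat0s.
by apply: TensorCat IHs; rewrite scale0r; apply: TensorZero.
Qed.

Let scaleA a b t : tensor_scale a (tensor_scale b t) = tensor_scale (a * b) t.
Proof.
elim/tensorW: t => s; rewrite !seq_scale -map_comp; congr tensor_of_seq.
by apply: eq_map => p /=; rewrite scalerA.
Qed.

Let scale1 : left_id 1 tensor_scale.
Proof.
elim/tensorW=> s; rewrite seq_scale; congr tensor_of_seq.
by rewrite -[RHS]map_id; apply: eq_map => -[x y] /=; rewrite scale1r.
Qed.

Let scaleDr : right_distributive tensor_scale tensor_add.
Proof.
move=> a; elim/tensorW=> s; elim/tensorW=> t.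
by rewrite !(seq_add, seq_scale) map_cat.
Qed.

Let tensor_addN : left_inverse (tensor_of_seq [::]) tensor_opp tensor_add.
Proof.
by move=> t; rewrite -{2}[t]scale1 /tensor_opp -scaleDl addNr scale0.
Qed.

HB.instance Definition _ := GRing.isZmodule.Build tensor
  tensor_addA tensor_addC tensor_add0 tensor_addN.

HB.instance Definition _ := GRing.Zmodule_isLmodule.Build k tensor
  scaleA scale1 scaleDr scaleDl.

Lemma tensor_of_seqE s : tensor_of_seq s = \sum_(p <- s) pure p.1 p.2.
Proof.
elim: s => [|[x y] s IHs]; first by rewrite big_nil.
by rewrite big_cons -IHs -cat1s -seq_add.
Qed.

Lemma pure_bilinear : is_bilinear pure.
Proof.
split=> [y a x x'|x a y y'] /=.
- have -> : a *: pure x y = pure (a *: x) y by apply: seq_scale.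
  have -> : pure (a *: x) y + pure x' y =
    tensor_of_seq [:: (a *: x, y); (x', y)] by apply: seq_add.
  exact/tensor_of_seqP/TensorAddl.
- have -> : a *: pure x y = pure (a *: x) y by apply: seq_scale.
  have -> : pure (a *: x) y = pure x (a *: y) by exact/tensor_of_seqP/TensorScale.
  have -> : pure x (a *: y) + pure x y' =
    tensor_of_seq [:: (x, a *: y); (x, y')] by apply: seq_add.
  exact/tensor_of_seqP/TensorAddr.
Qed.

(* Only meaningful for bilinear f, see [tensor_lift_pure]. *)
Definition tensor_lift (P : lmodType k) (f : M -> N -> P) (t : tensor) : P :=
  \sum_(p <- repr t) f p.1 p.2.

Let lift_rel (P : lmodType k) (f : M -> N -> P) (s t : seq (M * N)) :
  is_bilinear f -> tensor_rel s t ->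
  \sum_(p <- s) f p.1 p.2 = \sum_(p <- t) f p.1 p.2.
Proof.
move=> [fl fr]; have f0 y : f 0 y = 0.
  by have := fl y (- 1) 0 0; rewrite scaler0 addr0 scaleN1r addNr.
have f0r x : f x 0 = 0.
  by have := fr x (- 1) 0 0; rewrite scaler0 addr0 scaleN1r addNr.
elim=> {s t} //=.
- by move=> s t u _ -> _ ->.
- by move=> s s' t t' _ es _ et; rewrite !big_cat es et.
- by move=> s t; rewrite !big_cat /= addrC.
- by move=> y; rewrite big_seq1 big_nil f0.
- move=> x x' y; rewrite !(big_cons, big_nil) /= !addr0.
  by have := fl y 1 x x'; rewrite !scale1r.
- move=> x y y'; rewrite !(big_cons, big_nil) /= !addr0.
  by have := fr x 1 y y'; rewrite !scale1r.
- move=> a x y; rewrite !big_seq1 /=.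
  have := fl y a x 0; rewrite !addr0 f0 addr0 => ->.
  by have := fr x a y 0; rewrite !addr0 f0r addr0 => ->.
Qed.

Let lift_seq (P : lmodType k) (f : M -> N -> P) s : is_bilinear f ->
  tensor_lift f (tensor_of_seq s) = \sum_(p <- s) f p.1 p.2.
Proof. by move=> fbil; apply/lift_rel/tensor_repr_rel. Qed.

Lemma tensor_lift_pure (P : lmodType k) (f : M -> N -> P) x y :
  is_bilinear f -> tensor_lift f (pure x y) = f x y.
Proof. by move=> fbil; rewrite lift_seq // big_seq1. Qed.

Lemma tensor_lift_linear (P : lmodType k) (f : M -> N -> P) :
  is_bilinear f -> linear (tensor_lift f).
Proof.
move=> fbil a; elim/tensorW=> s; elim/tensorW=> t.
have -> : a *: tensor_of_seq s + tensor_of_seq t =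
    tensor_of_seq ([seq (a *: p.1, p.2) | p <- s] ++ t).
  by rewrite -seq_add -seq_scale.
rewrite !lift_seq // big_cat big_map /= scaler_sumr; congr (_ + _).
apply: eq_bigr => p _ /=; have := fbil.1 p.2 a p.1 0.
have := fbil.1 p.2 (- 1) 0 0; rewrite scaler0 addr0 scaleN1r addNr => ->.
by rewrite !addr0.
Qed.

Lemma tensor_ext (P : lmodType k) (f g : {linear tensor -> P}) :
  (forall x y, f (pure x y) = g (pure x y)) -> f =1 g.
Proof.
move=> fg; elim/tensorW=> s; rewrite tensor_of_seqE !linear_sum.
by apply: eq_bigr => p _.
Qed.

End Tensor.

Notation "M ⊗ N" := (tensor M N) (at level 40, left associativity) : type_scope.

HB.instance Definition _ (k : comPzRingType) (M N : lmodType k) (x : M) :=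
  GRing.isLinear.Build k N (M ⊗ N)%type _ (pure x) ((pure_bilinear M N).2 x).

Section TensorMaps.
Variable k : comPzRingType.
Implicit Types M N P : lmodType k.

Let pureDl M N (a : k) (x x' : M) (y : N) :
  pure (a *: x + x') y = a *: pure x y + pure x' y.
Proof. exact: (pure_bilinear M N).1. Qed.

Definition tensor_map M M' N N' (f : {linear M -> M'}) (g : {linear N -> N'}) :
    M ⊗ N -> M' ⊗ N' :=
  tensor_lift (fun x y => pure (f x) (g y)).

Let tensor_map_bilinear M M' N N' (f : {linear M -> M'}) (g : {linear N -> N'}) :
  is_bilinear (fun x y => pure (f x) (g y)).
Proof. by split=> [y a x x'|x a y y'] /=; rewrite linearP ?pureDl ?linearP. Qed.

HB.instance Definition _ M M' N N' (f : {linear M -> M'}) (g : {linear N -> N'}) :=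
  GRing.isLinear.Build k (M ⊗ N)%type (M' ⊗ N')%type _ (tensor_map f g)
    (tensor_lift_linear (tensor_map_bilinear f g)).

Lemma tensor_map_pure M M' N N' (f : {linear M -> M'}) (g : {linear N -> N'}) x y :
  tensor_map f g (pure x y) = pure (f x) (g y).
Proof. exact/tensor_lift_pure/tensor_map_bilinear. Qed.

Definition tensor_swap M N : M ⊗ N -> N ⊗ M :=
  tensor_lift (fun x y => pure y x).

Let tensor_swap_bilinear M N : is_bilinear (fun (x : M) (y : N) => pure y x).
Proof. by split=> [y a x x'|x a y y'] /=; rewrite ?pureDl ?linearP. Qed.

HB.instance Definition _ M N :=
  GRing.isLinear.Build k (M ⊗ N)%type (N ⊗ M)%type _ (@tensor_swap M N)
    (tensor_lift_linear (@tensor_swap_bilinear M N)).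

Lemma tensor_swap_pure M N (x : M) (y : N) : tensor_swap (pure x y) = pure y x.
Proof. exact/tensor_lift_pure/tensor_swap_bilinear. Qed.

Definition tensor_assoc M N P : (M ⊗ N) ⊗ P -> M ⊗ (N ⊗ P) :=
  tensor_lift (fun t z => tensor_lift (fun x y => pure x (pure y z)) t).

Let tensor_assoc_bilinear1 M N P (z : P) :
  is_bilinear (fun (x : M) (y : N) => pure x (pure y z)).
Proof. by split=> [y a x x'|x a y y'] /=; rewrite pureDl ?linearP. Qed.

Let tensor_assoc_bilinear M N P : is_bilinear (fun (t : M ⊗ N) (z : P) =>
  tensor_lift (fun x y => pure x (pure y z)) t).
Proof.
split=> [z|t a z z'] /=; first exact/tensor_lift_linear/tensor_assoc_bilinear1.
rewrite /tensor_lift scaler_sumr -big_split /=.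
by apply: eq_bigr => p _; rewrite !linearP.
Qed.

HB.instance Definition _ M N P :=
  GRing.isLinear.Build k ((M ⊗ N) ⊗ P)%type (M ⊗ (N ⊗ P))%type _
    (@tensor_assoc M N P) (tensor_lift_linear (@tensor_assoc_bilinear M N P)).

Lemma tensor_assoc_pure M N P (x : M) (y : N) (z : P) :
  tensor_assoc (pure (pure x y) z) = pure x (pure y z).
Proof.
rewrite /tensor_assoc tensor_lift_pure; last exact: tensor_assoc_bilinear.
by rewrite tensor_lift_pure //; apply: tensor_assoc_bilinear1.
Qed.

Definition tensor_unitl M : k^o ⊗ M -> M :=
  tensor_lift (fun (a : k^o) x => (a : k) *: x).

Let tensor_unitl_bilinear M : is_bilinear (fun (a : k^o) (x : M) => (a : k) *: x).
Proof.
split=> [y a x x'|x a y y'] /=; first by rewrite scalerDl scalerA.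
by rewrite scalerDr !scalerA [_ * a]mulrC.
Qed.

HB.instance Definition _ M :=
  GRing.isLinear.Build k (k^o ⊗ M)%type M _ (@tensor_unitl M)
    (tensor_lift_linear (@tensor_unitl_bilinear M)).

Lemma tensor_unitl_pure M (a : k^o) (x : M) :
  tensor_unitl (pure a x) = (a : k) *: x.
Proof. exact/tensor_lift_pure/tensor_unitl_bilinear. Qed.

Definition tensor_unitr M : M ⊗ k^o -> M :=
  tensor_lift (fun x (a : k^o) => (a : k) *: x).

Let tensor_unitr_bilinear M : is_bilinear (fun (x : M) (a : k^o) => (a : k) *: x).
Proof.
split=> [y a x x'|x a y y'] /=; last by rewrite scalerDl scalerA.
by rewrite scalerDr !scalerA [_ * a]mulrC.
Qed.

HB.instance Definition _ M :=
  GRing.isLinear.Build k (M ⊗ k^o)%type M _ (@tensor_unitr M)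
    (tensor_lift_linear (@tensor_unitr_bilinear M)).

Lemma tensor_unitr_pure M (a : k^o) (x : M) :
  tensor_unitr (pure x a) = (a : k) *: x.
Proof. exact/tensor_lift_pure/tensor_unitr_bilinear. Qed.

End TensorMaps.

(** * Direct sums of sequences of modules *)

Record dsum (k : comPzRingType) (M : nat -> lmodType k) := DSum {
  dsum_coef :> forall n, M n;
  dsum_finsupp : exists b : nat, forall n, (b <= n)%N -> dsum_coef n = 0 }.

Section DirectSum.
Variables (k : comPzRingType) (M : nat -> lmodType k).

HB.instance Definition _ := gen_eqMixin (dsum M).
HB.instance Definition _ := gen_choiceMixin (dsum M).

Lemma dsumP (x y : dsum M) : (forall n, x n = y n) -> x = y.
Proof.
case: x y => [x xP] [y yP] /= xy.
have exy : x = y by apply: functional_extensionality_dep.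
by subst y; congr DSum; apply: Prop_irrelevance.
Qed.

Let dsum0_finsupp : exists b : nat, forall n, (b <= n)%N -> (0 : M n) = 0.
Proof. by exists 0%N. Qed.

Let dsum_opp_finsupp (x : dsum M) :
  exists b : nat, forall n, (b <= n)%N -> - x n = 0.
Proof. by have [b xb] := dsum_finsupp x; exists b => n /xb ->; rewrite oppr0. Qed.

Let dsum_scale_finsupp (a : k) (x : dsum M) :
  exists b : nat, forall n, (b <= n)%N -> a *: x n = 0.
Proof. by have [b xb] := dsum_finsupp x; exists b => n /xb ->; rewrite scaler0. Qed.

Let dsum_add_finsupp (x y : dsum M) :
  exists b : nat, forall n, (b <= n)%N -> x n + y n = 0.
Proof.
have [b xb] := dsum_finsupp x; have [c yc] := dsum_finsupp y.
by exists (maxn b c) => n; rewrite geq_max => /andP[/xb -> /yc ->]; rewrite addr0.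
Qed.

Definition dsum_zero := DSum dsum0_finsupp.
Definition dsum_opp x := DSum (dsum_opp_finsupp x).
Definition dsum_add x y := DSum (dsum_add_finsupp x y).
Definition dsum_scale a x := DSum (dsum_scale_finsupp a x).

Let dsum_addA : associative dsum_add.
Proof. by move=> x y z; apply: dsumP => n /=; rewrite addrA. Qed.
Let dsum_addC : commutative dsum_add.
Proof. by move=> x y; apply: dsumP => n /=; rewrite addrC. Qed.
Let dsum_add0 : left_id dsum_zero dsum_add.
Proof. by move=> x; apply: dsumP => n /=; rewrite add0r. Qed.
Let dsum_addN : left_inverse dsum_zero dsum_opp dsum_add.
Proof. by move=> x; apply: dsumP => n /=; rewrite addNr. Qed.

HB.instance Definition _ := GRing.isZmodule.Build (dsum M)
  dsum_addA dsum_addC dsum_add0 dsum_addN.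

Let dsum_scaleA a b x : dsum_scale a (dsum_scale b x) = dsum_scale (a * b) x.
Proof. by apply: dsumP => n /=; rewrite scalerA. Qed.
Let dsum_scale1 : left_id 1 dsum_scale.
Proof. by move=> x; apply: dsumP => n /=; rewrite scale1r. Qed.
Let dsum_scaleDr : right_distributive dsum_scale +%R.
Proof. by move=> a x y; apply: dsumP => n /=; rewrite scalerDr. Qed.
Let dsum_scaleDl x : {morph dsum_scale^~ x : a b / a + b}.
Proof. by move=> a b; apply: dsumP => n /=; rewrite scalerDl. Qed.

HB.instance Definition _ := GRing.Zmodule_isLmodule.Build k (dsum M)
  dsum_scaleA dsum_scale1 dsum_scaleDr dsum_scaleDl.

Definition dsum_in_coef n (x : M n) (m : nat) : M m :=
  if n =P m is ReflectT e then ecast i (M i) e x else 0.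

Let dsum_in_finsupp n (x : M n) :
  exists b : nat, forall m, (b <= m)%N -> dsum_in_coef x m = 0.
Proof.
exists n.+1 => m nm; rewrite /dsum_in_coef; case: eqP => // e.
by rewrite e ltnn in nm.
Qed.

Definition dsum_in n (x : M n) : dsum M := DSum (dsum_in_finsupp x).

Let dsum_in_linear n : linear (@dsum_in n).
Proof.
move=> a x y; apply: dsumP => m /=; rewrite /dsum_in_coef.
by case: eqP => [e|_]; [case: _ / e | rewrite scaler0 addr0].
Qed.

HB.instance Definition _ n :=
  GRing.isLinear.Build k (M n) (dsum M) _ (@dsum_in n) (@dsum_in_linear n).

Definition dsum_lift (P : lmodType k) (f : forall n, {linear M n -> P})
    (x : dsum M) : P :=
  \sum_(n < sval (cid (dsum_finsupp x))) f n (x n).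

Let dsum_lift_bound (P : lmodType k) (f : forall n, {linear M n -> P})
    (x : dsum M) (b : nat) :
  (forall n, (b <= n)%N -> x n = 0) -> dsum_lift f x = \sum_(n < b) f n (x n).
Proof.
rewrite /dsum_lift; case: cid => c /= xc xb.
have widen d e : (d <= e)%N -> (forall n, (d <= n)%N -> x n = 0) ->
    \sum_(n < d) f n (x n) = \sum_(n < e) f n (x n).
  move=> de xd; rewrite (big_ord_widen e (fun n => f n (x n)) de) big_mkcond /=.
  apply: eq_bigr => n _; case: ltnP => // /xd ->.
  by rewrite linear0.
by case/orP: (leq_total c b) => [/widen ->|/widen <-].
Qed.

Let dsum_lift_linear (P : lmodType k) (f : forall n, {linear M n -> P}) :
  linear (dsum_lift f).
Proof.
move=> a x y; have [b xb] := dsum_finsupp x; have [c yc] := dsum_finsupp y.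
have xm n : (maxn b c <= n)%N -> x n = 0 by rewrite geq_max => /andP[/xb].
have ym n : (maxn b c <= n)%N -> y n = 0 by rewrite geq_max => /andP[_ /yc].
rewrite (dsum_lift_bound f xm) (dsum_lift_bound f ym).
rewrite (@dsum_lift_bound _ f _ (maxn b c)) => [|n nm /=]; last first.
  by rewrite xm // ym // scaler0 addr0.
by rewrite scaler_sumr -big_split; apply: eq_bigr => n _ /=; rewrite linearP.
Qed.

HB.instance Definition _ (P : lmodType k) (f : forall n, {linear M n -> P}) :=
  GRing.isLinear.Build k (dsum M) P _ (dsum_lift f) (@dsum_lift_linear P f).

Lemma dsum_in_id n (x : M n) : dsum_in x n = x.
Proof. by rewrite /= /dsum_in_coef; case: eqP => // e; rewrite eq_axiomK. Qed.

Lemma dsum_in_neq n m (x : M n) : n != m -> dsum_in x m = 0.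
Proof. by rewrite /= /dsum_in_coef; case: eqP. Qed.

Lemma dsum_lift_in (P : lmodType k) (f : forall n, {linear M n -> P}) n (x : M n) :
  dsum_lift f (dsum_in x) = f n x.
Proof.
rewrite (@dsum_lift_bound _ f _ n.+1) => [|m nm]; last first.
  by rewrite dsum_in_neq // neq_ltn nm.
rewrite big_ord_recr /= -/(dsum_in x n) big1 ?add0r => [|i _].
  by congr (f n _); exact: dsum_in_id.
have /(dsum_in_neq x) /= -> : n != i by rewrite neq_ltn ltn_ord orbT.
by rewrite linear0.
Qed.

Lemma dsum_ext (P : lmodType k) (f g : {linear dsum M -> P}) :
  (forall n (x : M n), f (dsum_in x) = g (dsum_in x)) -> f =1 g.
Proof.
move=> fg x; have [b xb] := dsum_finsupp x.
suff -> : x = \sum_(n < b) dsum_in (x n).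
  by rewrite !linear_sum; apply: eq_bigr => n _; apply: fg.
have coefD n : {morph (fun y : dsum M => y n) : y z / y + z} by [].
have coef0 n : (0 : dsum M) n = 0 by [].
apply: dsumP => m; rewrite (big_morph _ (coefD m) (coef0 m)).
have [bm|mb] := leqP b m.
  rewrite xb // big1 // => i _; apply: dsum_in_neq.
  by rewrite neq_ltn (leq_trans (ltn_ord i)).
rewrite (bigD1 (Ordinal mb)) // big1 => [|i].
  by rewrite /= addr0; apply/esym/dsum_in_id.
by rewrite -val_eqE /= => im; apply: dsum_in_neq.
Qed.

End DirectSum.

(* The symmetry of graded modules: [koszul_swap_pure] is its usual formula
   a (x) b |-> (-1)^(|a||b|) b (x) a on homogeneous elements. *)
Section KoszulSwap.
Variables (k : comPzRingType) (M : nat -> lmodType k).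

Definition koszul_term m n (x : M m) (y : M n) : dsum M ⊗ dsum M :=
  (-1) ^+ (m * n)%N *: pure (dsum_in y) (dsum_in x).

Let koszul_term_linear m n (x : M m) : linear (@koszul_term m n x).
Proof.
move=> a y z; rewrite /koszul_term linearP (pure_bilinear _ _).1 scalerDr.
by rewrite !scalerA mulrC.
Qed.

HB.instance Definition _ m n (x : M m) :=
  GRing.isLinear.Build k (M n) (dsum M ⊗ dsum M)%type _ (@koszul_term m n x)
    (@koszul_term_linear m n x).

Definition koszul_row m (y : dsum M) (x : M m) : dsum M ⊗ dsum M :=
  dsum_lift (fun n => koszul_term x : {linear M n -> dsum M ⊗ dsum M}) y.

Let koszul_row_linear m (y : dsum M) : linear (@koszul_row m y).
Proof.
move=> a x z; rewrite /koszul_row /dsum_lift scaler_sumr -big_split /=.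
apply: eq_bigr => n _; rewrite /koszul_term !linearP.
by rewrite !scalerA mulrC.
Qed.

HB.instance Definition _ m (y : dsum M) :=
  GRing.isLinear.Build k (M m) (dsum M ⊗ dsum M)%type _ (@koszul_row m y)
    (@koszul_row_linear m y).

Definition koszul_swap_fun (x y : dsum M) : dsum M ⊗ dsum M :=
  dsum_lift (fun m => koszul_row y : {linear M m -> dsum M ⊗ dsum M}) x.

Let koszul_swap_bilinear : is_bilinear koszul_swap_fun.
Proof.
split=> [y a x x'|x a y y']; first by rewrite /koszul_swap_fun linearP.
rewrite /koszul_swap_fun /dsum_lift scaler_sumr -big_split /=.
by apply: eq_bigr => m _; rewrite /koszul_row linearP.
Qed.

Definition koszul_swap : dsum M ⊗ dsum M -> dsum M ⊗ dsum M :=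
  tensor_lift koszul_swap_fun.

HB.instance Definition _ :=
  GRing.isLinear.Build k (dsum M ⊗ dsum M)%type (dsum M ⊗ dsum M)%type _
    koszul_swap (tensor_lift_linear koszul_swap_bilinear).

Lemma koszul_swap_pure m n (x : M m) (y : M n) :
  koszul_swap (pure (dsum_in x) (dsum_in y)) =
  (-1) ^+ (m * n)%N *: pure (dsum_in y) (dsum_in x).
Proof.
rewrite /koszul_swap tensor_lift_pure; last exact: koszul_swap_bilinear.
by rewrite /koszul_swap_fun dsum_lift_in /= /koszul_row dsum_lift_in.
Qed.

End KoszulSwap.

(** * Cooperads with comultiplication *)

Definition idm (k : comPzRingType) (M : lmodType k) : {linear M -> M} := idfun.

(* [delta n p q i] is the cocomposition Delta_{p,q,i} : C(p+q-1) -> C(p) (x) C(q).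
   Its source is recorded by a free index n, so that composing cocompositions
   needs no transport along equalities of arities; [delta_out] makes it zero
   unless n = p + q - 1 and 1 <= i <= p, which extends the convention
   Delta_{0,q,i} = 0. *)
Record cooperad (k : comPzRingType) := Cooperad {
  cooperad_obj :> nat -> lmodType k;
  eps : {linear cooperad_obj 1%N -> k^o};
  delta : forall n p q i : nat,
    {linear cooperad_obj n -> cooperad_obj p ⊗ cooperad_obj q};
  delta_out : forall n p q i : nat,
    ~~ [&& n.+1 == (p + q)%N, (1 <= i)%N & (i <= p)%N] ->
    forall x, delta n p q i x = 0;
  delta_counitl : forall n x,
    tensor_unitl (tensor_map eps (idm _) (delta n 1 n 1 x)) = x;
  delta_counitr : forall n i x, (1 <= i <= n)%N ->
    tensor_unitr (tensor_map (idm _) eps (delta n n 1 i x)) = x;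
  delta_before : forall p q r i j : nat,
    (1 <= p)%N -> (1 <= i <= p)%N -> (1 <= j <= (p + q).-1)%N ->
    (i + q <= j)%N ->
    forall x : cooperad_obj (p + q + r).-2,
    tensor_assoc (tensor_map (delta (p + q).-1 p q i) (idm _)
      (delta (p + q + r).-2 (p + q).-1 r j x)) =
    tensor_map (idm _) (@tensor_swap k _ _)
      (tensor_assoc (tensor_map (delta (p + r).-1 p r (j - q).+1) (idm _)
        (delta (p + q + r).-2 (p + r).-1 q i x)));
  delta_nested : forall p q r i j : nat,
    (1 <= p)%N -> (1 <= i <= p)%N -> (1 <= j <= (p + q).-1)%N ->
    (j < i + q)%N -> (i <= j)%N ->
    forall x : cooperad_obj (p + q + r).-2,
    tensor_assoc (tensor_map (delta (p + q).-1 p q i) (idm _)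
      (delta (p + q + r).-2 (p + q).-1 r j x)) =
    tensor_map (idm _) (delta (q + r).-1 q r (j - i).+1)
      (delta (p + q + r).-2 p (q + r).-1 i x);
  delta_after : forall p q r i j : nat,
    (1 <= p)%N -> (1 <= i <= p)%N -> (1 <= j <= (p + q).-1)%N ->
    (j < i)%N ->
    forall x : cooperad_obj (p + q + r).-2,
    tensor_assoc (tensor_map (delta (p + q).-1 p q i) (idm _)
      (delta (p + q + r).-2 (p + q).-1 r j x)) =
    tensor_map (idm _) (@tensor_swap k _ _)
      (tensor_assoc (tensor_map (delta (p + r).-1 p r j) (idm _)
        (delta (p + q + r).-2 (p + r).-1 q (i + r).-1 x)))
}.

Record cooperad_comul (k : comPzRingType) := CooperadComul {
  cooperad_of_comul :> cooperad k;
  muc : {linear cooperad_of_comul 2%N -> k^o};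
  ec : {linear cooperad_of_comul 0%N -> k^o};
  muc_assoc : forall x : cooperad_of_comul 3%N,
    tensor_unitl (tensor_map muc muc (delta cooperad_of_comul 3 2 2 1 x)) =
    tensor_unitl (tensor_map muc muc (delta cooperad_of_comul 3 2 2 2 x));
  muc_ecl : forall x : cooperad_of_comul 1%N,
    tensor_unitl (tensor_map muc ec (delta cooperad_of_comul 1 2 0 1 x)) =
    eps cooperad_of_comul x;
  muc_ecr : forall x : cooperad_of_comul 1%N,
    tensor_unitl (tensor_map muc ec (delta cooperad_of_comul 1 2 0 2 x)) =
    eps cooperad_of_comul x
}.

Section DGCoalgebra.
Variables (k : comPzRingType) (C : cooperad_comul k).

Definition cooperad_total : lmodType k := dsum C.

Definition diff_at (n : nat) (x : C n) : C n.-1 :=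
  if n == 0%N then 0 else
  tensor_unitl (tensor_map (muc C) (idm _)
    (delta C n 2 n.-1 2 x + (-1) ^+ n *: delta C n 2 n.-1 1 x)) +
  \sum_(1 <= i < n)
    (-1) ^+ i *: tensor_unitr (tensor_map (idm _) (muc C) (delta C n n.-1 2 i x)).

Let diff_at_linear n : linear (@diff_at n).
Proof.
move=> a x y; rewrite /diff_at; case: eqP => _; first by rewrite scaler0 addr0.
rewrite [X in _ = X + _]scalerDr [RHS]addrACA; congr (_ + _).
  rewrite -!linearP; congr (tensor_unitl (tensor_map _ _ _)).
  by rewrite !linearP !scalerDr !scalerA [a * _]mulrC addrACA.
rewrite scaler_sumr -big_split /=.
by apply: eq_bigr => i _; rewrite !linearP.
Qed.

HB.instance Definition _ n :=
  GRing.isLinear.Build k (C n) (C n.-1) _ (@diff_at n) (@diff_at_linear n).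

Definition cooperad_diff : {linear cooperad_total -> cooperad_total} :=
  dsum_lift (fun n => @dsum_in k C n.-1 \o @diff_at n : {linear C n -> cooperad_total}).

Definition cup_summand (n j : nat) (x : C n) : C j.-1 ⊗ C (n.+1 - j)%N :=
  tensor_map
    (@tensor_unitl k (C j.-1) \o tensor_map (muc C) (idm _)
       \o delta C j 2 j.-1 1 : {linear C j -> C j.-1})
    (idm _) (delta C n j (n.+1 - j) j x).

Definition cup_at (n : nat) (x : C n) : cooperad_total ⊗ cooperad_total :=
  \sum_(1 <= j < n.+2)
    tensor_map (@dsum_in k C j.-1) (@dsum_in k C (n.+1 - j)) (cup_summand j x).

Let cup_at_linear n : linear (@cup_at n).
Proof.
move=> a x y; rewrite /cup_at scaler_sumr -big_split /=.
by apply: eq_bigr => j _; rewrite /cup_summand !linearP.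
Qed.

HB.instance Definition _ n :=
  GRing.isLinear.Build k (C n) (cooperad_total ⊗ cooperad_total)%type _ (@cup_at n)
    (@cup_at_linear n).

Definition cup_coproduct :
    {linear cooperad_total -> cooperad_total ⊗ cooperad_total} :=
  dsum_lift (@cup_at).

Definition counit_bar_at (n : nat) : {linear C n -> k^o} :=
  if n is 0%N then ec C else \0.

Definition counit_bar : {linear cooperad_total -> k^o} := dsum_lift counit_bar_at.

Lemma diff_in n (x : C n) : cooperad_diff (dsum_in x) = dsum_in (diff_at x).
Proof. exact: dsum_lift_in. Qed.

Lemma cup_in n (x : C n) : cup_coproduct (dsum_in x) = cup_at x.
Proof. exact: dsum_lift_in. Qed.

Lemma counit_bar_in0 (x : C 0%N) : counit_bar (dsum_in x) = ec C x.
Proof. exact: dsum_lift_in. Qed.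

Lemma counit_bar_inS n (x : C n.+1) : counit_bar (dsum_in x) = 0.
Proof. exact: dsum_lift_in. Qed.

End DGCoalgebra.

(* Main.v *)
Require Import Defs.
From HB Require Import structures.
From mathcomp Require Import all_boot all_order all_algebra.
From mathcomp Require Import zify.

Import GRing.Theory.
Local Open Scope ring_scope.

(* Let L and F be the last and first faces (muc (x) id) o Delta_{2,n,1} and
   (muc (x) id) o Delta_{2,n,2}, and M_i = (id (x) muc) o Delta_{n,2,i} the inner
   ones. Contracting one factor C(2) of the cooperad axioms with muc shows how a
   face commutes with an arbitrary Delta_{p,q,i}; contracting the remaining
   factor C(2) as well gives the simplicial identities, hence d o d = 0. The
   component C(p+q) -> C(p) (x) C(q) of the cup coproduct is
   (L (x) id) o Delta_{p+1,q,p+1} = swap o (F (x) id) o Delta_{q+1,p,1}. Like the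
   Alexander-Whitney map it turns a face d_i into d_i (x) id for i <= p and into
   id (x) d_{i-p} for i > p, while d_{p+1} (x) id and id (x) d_0 agree on it: in
   the Leibniz rule these two extra terms cancel. *)

(** * Tensor products of linear maps and contraction of a factor with a linear form *)

Section TensorCalculus.
Set Implicit Arguments.
Unset Strict Implicit.
Variable k : comPzRingType.
Implicit Types M N P Q : lmodType k.

Lemma pure_suml M N (I : Type) (s : seq I) (F : I -> M) (y : N) :
  pure (\sum_(i <- s) F i) y = \sum_(i <- s) pure (F i) y.
Proof.
have pureZ a (x x' : M) : pure (a *: x + x') y = a *: pure x y + pure x' y.
  exact: (pure_bilinear M N).1.
have pureD : {morph (fun x : M => pure x y) : x x' / x + x'}.
  by move=> x x'; have := pureZ 1 x x'; rewrite !scale1r.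
have pure0 : pure (0 : M) y = 0.
  by have := pureZ (-1) 0 0; rewrite scaler0 addr0 scaleN1r addNr.
exact: (big_morph _ pureD pure0).
Qed.

Lemma tensor_ext3 M N P Q (f g : {linear (M ⊗ N) ⊗ P -> Q}) :
  (forall x y z, f (pure (pure x y) z) = g (pure (pure x y) z)) -> f =1 g.
Proof.
move=> fg; apply: tensor_ext => t z.
rewrite -(tensor_reprK t) tensor_of_seqE pure_suml !linear_sum.
by apply: eq_bigr => p _.
Qed.

Lemma eq_tensor_map M M' N N' (f f' : {linear M -> M'}) (g g' : {linear N -> N'}) :
  f =1 f' -> g =1 g' -> tensor_map f g =1 tensor_map f' g'.
Proof. by move=> ff gg; apply: tensor_ext => x y /=; rewrite !tensor_map_pure ff gg. Qed.

Lemma tensor_map_comp M M' M'' N N' N'' (f : {linear M' -> M''})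
    (f' : {linear M -> M'}) (g : {linear N' -> N''}) (g' : {linear N -> N'}) t :
  tensor_map f g (tensor_map f' g' t) = tensor_map (f \o f') (g \o g') t.
Proof.
apply: (tensor_ext (f := tensor_map f g \o tensor_map f' g')) => x y /=.
by rewrite !tensor_map_pure.
Qed.

Lemma tensor_swap_map M M' N N' (f : {linear M -> M'}) (g : {linear N -> N'}) t :
  tensor_swap (tensor_map f g t) = tensor_map g f (tensor_swap t).
Proof.
apply: (tensor_ext (f := tensor_swap (N := N') \o tensor_map f g)
  (g := tensor_map g f \o tensor_swap (N := N))) => x y /=.
by rewrite !(tensor_map_pure, tensor_swap_pure).
Qed.

Lemma tensor_assoc_map M M' N N' P P' (f : {linear M -> M'}) (g : {linear N -> N'})
    (h : {linear P -> P'}) t :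
  tensor_assoc (tensor_map (tensor_map f g) h t) =
  tensor_map f (tensor_map g h) (tensor_assoc t).
Proof.
apply: (tensor_ext3 (f := @tensor_assoc k M' N' P' \o tensor_map (tensor_map f g) h)
  (g := tensor_map f (tensor_map g h) \o @tensor_assoc k M N P)) => x y z /=.
by rewrite !(tensor_map_pure, tensor_assoc_pure) /= !(tensor_map_pure, tensor_assoc_pure).
Qed.

Definition contractl M N (f : {linear M -> k^o}) (t : M ⊗ N) : N :=
  tensor_unitl (tensor_map f (idm N) t).

Definition contractr M N (f : {linear N -> k^o}) (t : M ⊗ N) : M :=
  tensor_unitr (tensor_map (idm M) f t).

HB.instance Definition _ M N (f : {linear M -> k^o}) :=
  GRing.Linear.copy (@contractl M N f) (@tensor_unitl k N \o tensor_map f (idm N)).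

HB.instance Definition _ M N (f : {linear N -> k^o}) :=
  GRing.Linear.copy (@contractr M N f) (@tensor_unitr k M \o tensor_map (idm M) f).

Lemma contractl_pure M N (f : {linear M -> k^o}) x (y : N) :
  contractl f (pure x y) = (f x : k) *: y.
Proof. by rewrite /contractl tensor_map_pure tensor_unitl_pure. Qed.

Lemma contractr_pure M N (f : {linear N -> k^o}) (x : M) y :
  contractr f (pure x y) = (f y : k) *: x.
Proof. by rewrite /contractr tensor_map_pure tensor_unitr_pure. Qed.

Lemma pureZl M N (a : k) (x : M) (y : N) : pure (a *: x) y = a *: pure x y.
Proof.
have := (pure_bilinear M N).1 y a x 0; rewrite !addr0 => ->.
have := (pure_bilinear M N).1 y (-1) 0 0.
by rewrite scaler0 addr0 scaleN1r addNr => ->; rewrite addr0.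
Qed.

Let pureE := (tensor_map_pure, tensor_swap_pure, tensor_assoc_pure,
  contractl_pure, contractr_pure).

Lemma contractl_map M M' N N' (f : {linear M' -> k^o}) (h : {linear M -> M'})
    (g : {linear N -> N'}) t :
  contractl f (tensor_map h g t) = g (contractl (f \o h) t).
Proof.
apply: (tensor_ext (f := @contractl _ N' f \o tensor_map h g)
  (g := g \o @contractl _ N (f \o h))) => x y /=.
by rewrite !pureE linearZ.
Qed.

Lemma contractr_map M M' N N' (f : {linear N' -> k^o}) (h : {linear N -> N'})
    (g : {linear M -> M'}) t :
  contractr f (tensor_map g h t) = g (contractr (f \o h) t).
Proof.
apply: (tensor_ext (f := @contractr M' _ f \o tensor_map g h)
  (g := g \o @contractr M _ (f \o h))) => x y /=.
by rewrite !pureE linearZ.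
Qed.

Lemma contractl_swap M N (f : {linear N -> k^o}) (t : M ⊗ N) :
  contractl f (tensor_swap t) = contractr f t.
Proof.
apply: (tensor_ext (f := @contractl _ M f \o @tensor_swap k M N)
  (g := @contractr M _ f)) => x y /=.
by rewrite !pureE.
Qed.

Lemma contractl_assoc M N P (f : {linear M -> k^o}) (t : (M ⊗ N) ⊗ P) :
  contractl f (tensor_assoc t) = tensor_map (@contractl M N f) (idm P) t.
Proof.
apply: (tensor_ext3 (f := @contractl _ (N ⊗ P)%type f \o @tensor_assoc k M N P)
  (g := tensor_map (@contractl M N f) (idm P))) => x y z /=.
by rewrite !pureE /= !pureE pureZl.
Qed.

Lemma contractr_assoc M N P (f : {linear P -> k^o}) (t : (M ⊗ N) ⊗ P) :
  tensor_map (idm M) (@contractr N P f) (tensor_assoc t) = contractr f t.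
Proof.
apply: (tensor_ext3 (f := tensor_map (idm M) (@contractr N P f) \o @tensor_assoc k M N P)
  (g := @contractr (M ⊗ N)%type _ f)) => x y z /=.
by rewrite !pureE /= !pureE linearZ.
Qed.

(** In a nested cocomposition a form on the middle factor may be absorbed by either neighbour. This
    moves [muc C] between an inner face of the outer factor and a first or last face of the inner
    one. *)
Lemma contract_mid_assoc M N P (f : {linear N -> k^o}) (t : (M ⊗ N) ⊗ P) :
  tensor_map (idm M) (@contractl N P f) (tensor_assoc t) =
  tensor_map (@contractr M N f) (idm P) t.
Proof.
apply: (tensor_ext3 (f := tensor_map (idm M) (@contractl N P f) \o @tensor_assoc k M N P)
  (g := tensor_map (@contractr M N f) (idm P))) => x y z /=.
by rewrite !pureE /= !pureE /= pureZl linearZ.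
Qed.

(** The right sides of the parallel cooperad axioms carry this swap; their middle factor is the last
    one before reassociation. *)
Lemma contractl_swap_assoc M N P (f : {linear P -> k^o}) (t : (M ⊗ N) ⊗ P) :
  tensor_map (idm M) (@contractl P N f)
    (tensor_map (idm M) (@tensor_swap k N P) (tensor_assoc t)) = contractr f t.
Proof.
rewrite tensor_map_comp -contractr_assoc.
by apply: eq_tensor_map => // u /=; apply: contractl_swap.
Qed.

Lemma contractr_mapl M M' N (g : {linear M -> M'}) (f : {linear N -> k^o}) t :
  contractr f (tensor_map g (idm N) t) = g (contractr f t).
Proof. exact: (contractr_map f (idm N)). Qed.

Lemma contractl_mapl M M' N (h : {linear M -> M'}) (f : {linear M' -> k^o}) t :
  contractl f (tensor_map h (idm N) t) = contractl (f \o h) t.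
Proof. exact: contractl_map. Qed.

Lemma contractr_mapr M N N' (h : {linear N -> N'}) (f : {linear N' -> k^o}) t :
  contractr f (tensor_map (idm M) h t) = contractr (f \o h) t.
Proof. exact: contractr_map. Qed.

Lemma eq_contractl M N (f f' : {linear M -> k^o}) : f =1 f' ->
  @contractl M N f =1 contractl f'.
Proof. by move=> ff t; congr tensor_unitl; apply: eq_tensor_map. Qed.

Lemma eq_contractr M N (f f' : {linear N -> k^o}) : f =1 f' ->
  @contractr M N f =1 contractr f'.
Proof. by move=> ff t; congr tensor_unitr; apply: eq_tensor_map. Qed.

Lemma contractr_swap M N (f : {linear M -> k^o}) (t : M ⊗ N) :
  contractr f (tensor_swap t) = contractl f t.
Proof.
apply: (tensor_ext (f := @contractr N M f \o @tensor_swap k M N)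
  (g := @contractl M N f)) => x y /=.
by rewrite !pureE.
Qed.

Lemma tensor_mapC M M' N N' (f : {linear M -> M'}) (g : {linear N -> N'}) t :
  tensor_map f (idm _) (tensor_map (idm _) g t) =
  tensor_map (idm _) g (tensor_map f (idm _) t).
Proof. by rewrite !tensor_map_comp; apply: eq_tensor_map. Qed.

(** Both sides unfold to the sum over the chosen representative of [t]. Vanishing and finite sums in
    one factor can then be treated pair by pair. *)
Lemma tensor_mapE M M' N N' (f : {linear M -> M'}) (g : {linear N -> N'}) t :
  tensor_map f g t = \sum_(p <- repr t) pure (f p.1) (g p.2).
Proof. by []. Qed.

Lemma pure0l M N (y : N) : pure (0 : M) y = 0.
Proof. by rewrite -(scale0r 0) pureZl scale0r. Qed.

Lemma tensor_map0l M M' N N' (f : {linear M -> M'}) (g : {linear N -> N'}) t :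
  (forall x, f x = 0) -> tensor_map f g t = 0.
Proof.
move=> f0; rewrite tensor_mapE big1 // => p _.
by rewrite f0 pure0l.
Qed.

Lemma tensor_map0r M M' N N' (f : {linear M -> M'}) (g : {linear N -> N'}) t :
  (forall y, g y = 0) -> tensor_map f g t = 0.
Proof. by move=> g0; rewrite tensor_mapE big1 // => p _; rewrite g0 linear0. Qed.

(** The decomposition of [f] is only asked pointwise, so that [f] may be [face_sum] or a restricted
    cup coproduct; the coefficients carry the signs of the faces. *)
Lemma tensor_map_suml M M' N N' (I : finType) (a : I -> k)
    (F : I -> {linear M -> M'}) (f : {linear M -> M'}) (g : {linear N -> N'}) t :
  (forall x, f x = \sum_i a i *: F i x) ->
  tensor_map f g t = \sum_i a i *: tensor_map (F i) g t.
Proof.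
move=> fE; under [RHS]eq_bigr do rewrite tensor_mapE scaler_sumr.
rewrite tensor_mapE exchange_big; apply: eq_bigr => p _ /=.
by rewrite fE pure_suml; apply: eq_bigr => i _; rewrite pureZl.
Qed.

Lemma tensor_map_sumr M M' N N' (I : finType) (a : I -> k)
    (G : I -> {linear N -> N'}) (f : {linear M -> M'}) (g : {linear N -> N'}) t :
  (forall x, g x = \sum_i a i *: G i x) ->
  tensor_map f g t = \sum_i a i *: tensor_map f (G i) t.
Proof.
move=> gE; under [RHS]eq_bigr do rewrite tensor_mapE scaler_sumr.
rewrite tensor_mapE exchange_big; apply: eq_bigr => p _ /=.
by rewrite gE linear_sum; apply: eq_bigr => i _; rewrite linearZ.
Qed.

End TensorCalculus.

(** * Faces of a cooperad and their exchange with cocompositions *)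

Section CooperadFaces.
Set Implicit Arguments.
Unset Strict Implicit.
Variables (k : comPzRingType) (C : cooperad_comul k).

(** The axiom with free arities tied by equations: it can be rewritten with in any presentation of
    the arities, and the side conditions become linear arithmetic. *)
Lemma delta_nestedE (p q r i j n m s : nat) (x : C n) :
  m.+1 = (p + q)%N -> n.+1 = (m + r)%N -> s.+1 = (q + r)%N ->
  (0 < i <= p)%N -> (i <= j < i + q)%N ->
  tensor_assoc (tensor_map (delta C m p q i) (idm _) (delta C n m r j x)) =
  tensor_map (idm _) (delta C s q r (j - i).+1) (delta C n p s i x).
Proof.
move=> em en es ip ij.
have em' : m = (p + q).-1 by lia.
have en' : n = (p + q + r).-2 by lia.
have es' : s = (q + r).-1 by lia.
by subst m n s; apply: delta_nested; lia.
Qed.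

Lemma delta_beforeE (p q r i j n m s : nat) (x : C n) :
  m.+1 = (p + q)%N -> n.+1 = (m + r)%N -> s.+1 = (p + r)%N ->
  (0 < i <= p)%N -> (i + q <= j <= m)%N ->
  tensor_assoc (tensor_map (delta C m p q i) (idm _) (delta C n m r j x)) =
  tensor_map (idm _) (@tensor_swap k _ _)
    (tensor_assoc (tensor_map (delta C s p r (j - q).+1) (idm _)
      (delta C n s q i x))).
Proof.
move=> em en es ip ij.
have em' : m = (p + q).-1 by lia.
have en' : n = (p + q + r).-2 by lia.
have es' : s = (p + r).-1 by lia.
by subst m n s; apply: delta_before; lia.
Qed.

Definition first_face n (x : C n.+1) : C n :=
  contractl (muc C) (delta C n.+1 2 n 2 x).

Definition last_face n (x : C n.+1) : C n :=
  contractl (muc C) (delta C n.+1 2 n 1 x).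

Definition inner_face n i (x : C n.+1) : C n :=
  contractr (muc C) (delta C n.+1 n 2 i x).

HB.instance Definition _ n := GRing.Linear.copy (@first_face n)
  (@contractl k _ _ (muc C) \o delta C n.+1 2 n 2).

HB.instance Definition _ n := GRing.Linear.copy (@last_face n)
  (@contractl k _ _ (muc C) \o delta C n.+1 2 n 1).

HB.instance Definition _ n i := GRing.Linear.copy (@inner_face n i)
  (@contractr k _ _ (muc C) \o delta C n.+1 n 2 i).

(** Nested axiom with outer factor [C 2] and middle factor in its slot 1; contract the outer
    factor. *)
Lemma delta_last_face n q r j (x : C n.+1) :
  n.+1 = (q + r)%N -> (0 < j <= q)%N ->
  tensor_map (@last_face q) (idm _) (delta C n.+1 q.+1 r j x) =
  delta C n q r j (last_face x).
Proof.
move=> en jq; rewrite /last_face.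
have := @delta_nestedE 2 q r 1 j n.+1 q.+1 n x.
rewrite (_ : (j - 1).+1 = j); last by lia.
move=> /(_ _ _ _ _ _)/(congr1 (contractl (muc C))).
rewrite contractl_assoc tensor_map_comp contractl_map.
by apply; lia.
Qed.

(** The same with slot 2 of [C 2]. The inputs of that slot are numbered from 2, hence the shift from
    [j.+1] to [j]. *)
Lemma delta_first_face n q r j (x : C n.+1) :
  n.+1 = (q + r)%N -> (0 < j <= q)%N ->
  tensor_map (@first_face q) (idm _) (delta C n.+1 q.+1 r j.+1 x) =
  delta C n q r j (first_face x).
Proof.
move=> en jq; rewrite /first_face.
have := @delta_nestedE 2 q r 2 j.+1 n.+1 q.+1 n x.
rewrite (_ : (j.+1 - 2).+1 = j); last by lia.
move=> /(_ _ _ _ _ _)/(congr1 (contractl (muc C))).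
rewrite contractl_assoc tensor_map_comp contractl_map.
by apply; lia.
Qed.

(** Nested axiom with innermost factor [C 2], which is contracted. Position [i + j] of the whole is
    position [j.+1] of the block inserted at [i]. *)
Lemma delta_inner_face n p q i j (x : C n.+1) :
  n.+1 = (p + q)%N -> (0 < i <= p)%N -> (j < q)%N ->
  tensor_map (idm _) (@inner_face q j.+1) (delta C n.+1 p q.+1 i x) =
  delta C n p q i (inner_face (i + j)%N x).
Proof.
move=> en ip jq; rewrite /inner_face.
have := @delta_nestedE p q 2 i (i + j) n.+1 n q.+1 x.
rewrite (_ : (i + j - i).+1 = j.+1); last by lia.
move=> /(_ _ _ _ _ _)/(congr1 (tensor_map (idm _) (contractr (muc C)))).
rewrite contractr_assoc contractr_map tensor_map_comp => -> //; lia.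
Qed.

(** Parallel axiom: the contracted [C 2] sits at [i], left of the block, and merging its two inputs
    moves the block from [j.+1] to [j]. *)
Lemma delta_inner_face_before n p r i j (x : C n.+1) :
  n.+1 = (p + r)%N -> (0 < i < j)%N -> (j <= p)%N ->
  tensor_map (inner_face i) (idm _) (delta C n.+1 p.+1 r j.+1 x) =
  delta C n p r j (inner_face i x).
Proof.
move=> en ip jp; rewrite /inner_face.
have := @delta_beforeE p 2 r i j.+1 n.+1 p.+1 n x.
rewrite (_ : (j.+1 - 2).+1 = j); last by lia.
move=> /(_ _ _ _ _ _)/(congr1 (tensor_map (idm _) (contractl (muc C)))).
rewrite contract_mid_assoc contractl_swap_assoc contractr_map tensor_map_comp.
by apply; lia.
Qed.

(** Here [C 2] is the middle factor of a nested decomposition with the block in its slot 1: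
    contracted into the outer factor it is an inner face, into the block a last face. With slot 2
    the block gets a first face instead, as in the next lemma. *)
Lemma delta_inner_face_left n p r i (x : C n) :
  n = (p + r)%N -> (0 < i <= p)%N ->
  tensor_map (inner_face i) (idm _) (delta C n p.+1 r i x) =
  tensor_map (idm _) (@last_face r) (delta C n p r.+1 i x).
Proof.
move=> en ip; rewrite /inner_face /last_face.
have := @delta_nestedE p 2 r i i n p.+1 r.+1 x.
rewrite subnn => /(_ _ _ _ _ _)/(congr1 (tensor_map (idm _) (contractl (muc C)))).
rewrite contract_mid_assoc !tensor_map_comp.
by apply; lia.
Qed.

Lemma delta_inner_face_right n p r i (x : C n) :
  n = (p + r)%N -> (0 < i <= p)%N ->
  tensor_map (inner_face i) (idm _) (delta C n p.+1 r i.+1 x) =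
  tensor_map (idm _) (@first_face r) (delta C n p r.+1 i x).
Proof.
move=> en ip; rewrite /inner_face /first_face.
have := @delta_nestedE p 2 r i i.+1 n p.+1 r.+1 x.
rewrite subSnn => /(_ _ _ _ _ _)/(congr1 (tensor_map (idm _) (contractl (muc C)))).
rewrite contract_mid_assoc !tensor_map_comp.
by apply; lia.
Qed.

(** Two blocks fill the two slots of [C 2], and the parallel axiom lets them be split off in either
    order; then [C 2] is contracted. *)
Lemma delta_last_first_face n q r (x : C n) :
  n = (q + r)%N ->
  tensor_map (@last_face q) (idm _) (delta C n q.+1 r q.+1 x) =
  tensor_swap (tensor_map (@first_face r) (idm _) (delta C n r.+1 q 1 x)).
Proof.
move=> en; rewrite /first_face /last_face.
have := @delta_beforeE 2 q r 1 q.+1 n q.+1 r.+1 x.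
rewrite subSnn => /(_ _ _ _ _ _)/(congr1 (contractl (muc C))).
rewrite contractl_assoc contractl_map.
rewrite (_ : contractl _ _ = tensor_map (@contractl k _ _ (muc C)) (idm _)
  (tensor_map (delta C r.+1 2 r 2) (idm (C q)) (delta C n r.+1 q 1 x))).
  by rewrite !tensor_map_comp; apply; lia.
exact: contractl_assoc.
Qed.

(* The only place where coassociativity of the comultiplication enters. *)
Lemma muc_last_first (x : C 3) : muc C (last_face x) = muc C (first_face x).
Proof.
have muE (y : C 2 ⊗ C 2) : muc C (contractl (muc C) y) =
    tensor_unitl (tensor_map (muc C) (muc C) y).
  rewrite -(contractl_map _ (idm _)) /contractl tensor_map_comp.
  by congr tensor_unitl; apply: eq_tensor_map.
by rewrite /last_face /first_face !muE muc_assoc.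
Qed.

Lemma ec_last_face (x : C 1) : ec C (last_face x) = eps C x.
Proof.
rewrite -muc_ecl /last_face -(contractl_map _ (idm _)) /contractl tensor_map_comp.
by congr tensor_unitl; apply: eq_tensor_map.
Qed.

Lemma ec_first_face (x : C 1) : ec C (first_face x) = eps C x.
Proof.
rewrite -muc_ecr /first_face -(contractl_map _ (idm _)) /contractl tensor_map_comp.
by congr tensor_unitl; apply: eq_tensor_map.
Qed.

(** * Simplicial identities *)

Lemma inner_inner_face n i j (x : C n.+2) :
  (0 < i < j)%N -> (j <= n.+1)%N ->
  inner_face i (inner_face j x) = inner_face j.-1 (inner_face i x).
Proof.
move=> ij jn; rewrite [inner_face j x]/inner_face -(contractr_mapl (inner_face i)).
(* Adjacent faces overlap: both sides contract Delta_{n,3,i}, through the two composites from [C 3]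
   to [k] that coassociativity identifies. Other pairs are disjoint and follow from the parallel
   axiom. *)
have [ji|ij1] := eqVneq j i.+1.
  rewrite ji delta_inner_face_right ?contractr_mapr; try lia.
  rewrite [inner_face i x]/inner_face -(contractr_mapl (inner_face i)).
  rewrite delta_inner_face_left ?contractr_mapr; try lia.
  by apply: eq_contractr => y /=; rewrite muc_last_first.
case: j => [|j] in ij jn ij1 *; first by lia.
by rewrite delta_inner_face_before //; lia.
Qed.

Lemma last_inner_face n i (x : C n.+2) : (0 < i <= n)%N ->
  last_face (inner_face i x) = inner_face i (last_face x).
Proof.
move=> lei; rewrite [inner_face i x]/inner_face -(contractr_mapl (@last_face n)).
by rewrite delta_last_face //; lia.
Qed.

Lemma first_inner_face n i (x : C n.+2) : (0 < i <= n)%N ->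
  first_face (inner_face i.+1 x) = inner_face i (first_face x).
Proof.
move=> lei; rewrite [inner_face i.+1 x]/inner_face -(contractr_mapl (@first_face n)).
by rewrite delta_first_face //; lia.
Qed.

(** Both sides contract the factor [C 3] of Delta_{3,n,1}, by [muc C] after [last_face] and after
    [first_face] respectively. The next two identities arise in this way from Delta_{3,n,3} and
    Delta_{3,n,2}. *)
Lemma last_last_face n (x : C n.+2) :
  last_face (last_face x) = last_face (inner_face n.+1 x).
Proof.
rewrite [last_face (last_face x)]/last_face -delta_last_face // contractl_mapl.
rewrite /inner_face -(contractr_mapl (@last_face n)) delta_last_first_face; last by lia.
rewrite contractr_swap contractl_mapl.
by apply: eq_contractl => y /=; rewrite muc_last_first.
Qed.

Lemma first_first_face n (x : C n.+2) :
  first_face (first_face x) = first_face (inner_face 1 x).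
Proof.
rewrite [first_face (first_face x)]/first_face -delta_first_face // contractl_mapl.
rewrite /inner_face -(contractr_mapl (@first_face n)).
rewrite -contractl_swap -delta_last_first_face; last by lia.
rewrite contractl_mapl.
by apply: eq_contractl => y /=; rewrite muc_last_first.
Qed.

Lemma first_last_face n (x : C n.+2) :
  first_face (last_face x) = last_face (first_face x).
Proof.
rewrite [first_face (last_face x)]/first_face -delta_last_face // contractl_mapl.
rewrite [last_face (first_face x)]/last_face -delta_first_face // contractl_mapl.
by apply: eq_contractl => y /=; rewrite muc_last_first.
Qed.

(** * Components of the cup coproduct: exchange with faces, coassociativity, counits *)

Definition cup n p q (x : C n) : C p ⊗ C q :=
  tensor_map (@last_face p) (idm _) (delta C n p.+1 q p.+1 x).

HB.instance Definition _ n p q := GRing.Linear.copy (@cup n p q)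
  (tensor_map (@last_face p) (idm _) \o delta C n p.+1 q p.+1).

(** Allows sums over [p + q = n] to be extended to all pairs in a box. *)
Lemma cup_out n p q (x : C n) : n != (p + q)%N -> cup p q x = 0.
Proof.
by move=> npq; rewrite /cup delta_out ?linear0 //; lia.
Qed.

Lemma cup_first_faceE n p q (x : C n) : n = (p + q)%N ->
  cup p q x = tensor_swap (tensor_map (@first_face q) (idm _) (delta C n q.+1 p 1 x)).
Proof. exact: delta_last_first_face. Qed.

Lemma cup_first_face n p q (x : C n.+1) : n = (p + q)%N ->
  cup p q (first_face x) = tensor_map (@first_face p) (idm _) (cup p.+1 q x).
Proof.
move=> en; rewrite /cup -delta_first_face ?tensor_map_comp; try lia.
by apply: eq_tensor_map => // y /=; rewrite first_last_face.
Qed.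

(** In the form of [cup_first_faceE] the right factor of the cup is the outer factor of the
    cocomposition, where [delta_last_face] acts. *)
Lemma cup_last_face n p q (x : C n.+1) : n = (p + q)%N ->
  cup p q (last_face x) = tensor_map (idm _) (@last_face q) (cup p q.+1 x).
Proof.
move=> en; rewrite !cup_first_faceE; try lia.
rewrite -delta_last_face -?tensor_swap_map ?tensor_map_comp; try lia.
congr tensor_swap; apply: eq_tensor_map => // y /=.
by rewrite first_last_face.
Qed.

Lemma cup_inner_face_left n p q i (x : C n.+1) : n = (p + q)%N -> (0 < i <= p)%N ->
  cup p q (inner_face i x) = tensor_map (inner_face i) (idm _) (cup p.+1 q x).
Proof.
move=> en lei; rewrite /cup -delta_inner_face_before ?tensor_map_comp; try lia.
by apply: eq_tensor_map => // y /=; rewrite last_inner_face.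
Qed.

Lemma cup_inner_face_right n p q i (x : C n.+1) : n = (p + q)%N -> (0 < i <= q)%N ->
  cup p q (inner_face (p + i)%N x) = tensor_map (idm _) (inner_face i) (cup p q.+1 x).
Proof.
case: i => // i en lei; rewrite /cup addnS -addSn.
rewrite -delta_inner_face ?tensor_map_comp; try lia.
by apply: eq_tensor_map.
Qed.

(** A first face of the right factor is the inner face [p.+1] of [C p.+2], and after it [last_face]
    agrees with two last faces. *)
Lemma cup_last_first n p q (x : C n.+1) : n = (p + q)%N ->
  tensor_map (@last_face p) (idm _) (cup p.+1 q x) =
  tensor_map (idm _) (@first_face q) (cup p q.+1 x).
Proof.
move=> en; rewrite /cup -tensor_mapC -delta_inner_face_right ?tensor_map_comp; try lia.
by apply: eq_tensor_map => // y /=; rewrite last_last_face.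
Qed.

(** Both sides are the nested cocomposition into [C p.+1], [C q.+1] and [C r], always in the last
    slot, followed by a last face on each of the first two factors. *)
Lemma cup_coassoc n m s p q r (x : C n) :
  m = (p + q)%N -> s = (q + r)%N -> n = (m + r)%N ->
  tensor_assoc (tensor_map (@cup m p q) (idm _) (cup m r x)) =
  tensor_map (idm _) (@cup s q r) (cup p s x).
Proof.
move=> em es en.
(* The last face hidden in [cup m r] is carried through [cup p q] onto the middle factor by
   [cup_last_face]. *)
have -> : tensor_map (@cup m p q) (idm _) (cup m r x) =
    tensor_map (tensor_map (@last_face p) (@last_face q)) (idm _)
      (tensor_map (delta C m.+1 p.+1 q.+1 p.+1) (idm _) (delta C n m.+1 r m.+1 x)).
  rewrite /cup !tensor_map_comp; apply: eq_tensor_map => // y /=.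
  by rewrite -/(cup p q _) cup_last_face // /cup tensor_map_comp; apply: eq_tensor_map.
rewrite tensor_assoc_map (@delta_nestedE _ _ _ _ _ _ _ s); try lia.
rewrite (_ : (m.+1 - p.+1).+1 = q.+1); last by lia.
by rewrite /cup !tensor_map_comp; apply: eq_tensor_map.
Qed.

Lemma ec_cupl n (x : C n) : contractl (ec C) (cup 0 n x) = x.
Proof.
rewrite /cup contractl_mapl -[RHS]delta_counitl.
by apply: eq_contractl => y /=; rewrite ec_last_face.
Qed.

(** In its first-face form this component lies over Delta_{1,n,1}, so the left counit axiom of the
    cooperad gives the right counit law as well. *)
Lemma ec_cupr n (x : C n) : contractr (ec C) (cup n 0 x) = x.
Proof.
rewrite cup_first_faceE ?addn0 // contractr_swap contractl_mapl -[RHS]delta_counitl.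
by apply: eq_contractl => y /=; rewrite ec_first_face.
Qed.

(** * Uniformly indexed faces and their alternating sum *)

Definition face n i (x : C n.+1) : C n :=
  if i == 0%N then first_face x else
  if i == n.+1 then last_face x else inner_face i x.

Lemma face_is_linear n i : linear (@face n i).
Proof. by move=> a x y; rewrite /face; case: eqP => _; last case: eqP => _; rewrite linearP. Qed.

HB.instance Definition _ n i :=
  GRing.isLinear.Build k (C n.+1) (C n) _ (@face n i) (@face_is_linear n i).

Lemma face0 n (x : C n.+1) : face 0 x = first_face x.
Proof. by []. Qed.

Lemma face_last n (x : C n.+1) : face n.+1 x = last_face x.
Proof. by rewrite /face eqxx. Qed.

Lemma face_inner n i (x : C n.+1) : (0 < i <= n)%N -> face i x = inner_face i x.
Proof.
by move=> lei; rewrite /face; do 2![case: eqP => [?|_]; first by lia].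
Qed.

Lemma face_face n i j (x : C n.+2) : (i < j <= n.+2)%N ->
  face i (face j x) = face j.-1 (face i x).
Proof.
case: j => // j /andP[ij jn].
(* Four cases: [i] first or not, the upper index [j.+1] last or not. In the mixed cases [face j] may
   itself be the first face, or [face i] on the smaller arity the last one. *)
have [->|i0] := posnP i; have [ej|nj] := eqVneq j n.+1.
- by rewrite ej /= !face_last !face0 first_last_face.
- rewrite !face0 (face_inner (i := j.+1)); last by lia.
  have [->|j0] := posnP j; first by rewrite face0 first_first_face.
  by rewrite face_inner ?first_inner_face //; lia.
- rewrite ej /= !face_last (face_inner x); last by lia.
  have [->|ni] := eqVneq i n.+1; first by rewrite face_last last_last_face.
  by rewrite face_inner ?last_inner_face //; lia.
- rewrite (face_inner (i := j.+1)) ?(face_inner (i := i) x); try lia.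
  rewrite (face_inner (i := i)); last by lia.
  rewrite (face_inner (i := j)); last by lia.
  by rewrite inner_inner_face //; lia.
Qed.

Definition face_sum n (x : C n.+1) : C n := \sum_(i < n.+2) (-1) ^+ i *: face i x.

Lemma face_sum_is_linear n : linear (@face_sum n).
Proof.
move=> a x y; rewrite /face_sum scaler_sumr -big_split; apply: eq_bigr => i _ /=.
by rewrite linearP scalerDr !scalerA mulrC.
Qed.

HB.instance Definition _ n :=
  GRing.isLinear.Build k (C n.+1) (C n) _ (@face_sum n) (@face_sum_is_linear n).

(** The slot 2 term of the differential is face 0, and the slot 1 term, with sign (-1)^(n+1) on
    [C n.+1], is face n+1. *)
Lemma diff_atS n (x : C n.+1) : diff_at x = face_sum x.
Proof.
rewrite /face_sum big_ord_recl big_ord_recr expr0 scale1r face0 face_last.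
rewrite [_ (lift ord0 ord_max)]/=.
rewrite /diff_at /= !linearD !linearZ /= addrAC addrA.
congr (_ + _ + _).
rewrite big_add1 big_mkord; apply: eq_bigr => i _.
by rewrite face_inner ?bump0 ?ltn_ord.
Qed.

Lemma diff_at0 (x : C 0) : diff_at x = 0.
Proof. by []. Qed.

Lemma cup_face_left n p q i (x : C n.+1) : n = (p + q)%N -> (i <= p)%N ->
  cup p q (face i x) = tensor_map (face i) (idm _) (cup p.+1 q x).
Proof.
move=> en lei; have [->|i0] := posnP i.
  by rewrite face0 cup_first_face //; apply: eq_tensor_map.
rewrite face_inner ?cup_inner_face_left; try lia.
by apply: eq_tensor_map => // y /=; rewrite face_inner //; lia.
Qed.

Lemma cup_face_right n p q i (x : C n.+1) : n = (p + q)%N -> (0 < i <= q.+1)%N ->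
  cup p q (face (p + i)%N x) = tensor_map (idm _) (face i) (cup p q.+1 x).
Proof.
move=> en lei; have [ei|i0] := eqVneq i q.+1.
  rewrite (_ : (p + i)%N = n.+1) ?face_last ?cup_last_face; try lia.
  by apply: eq_tensor_map => // y /=; rewrite ei face_last.
rewrite face_inner ?cup_inner_face_right; try lia.
by apply: eq_tensor_map => // y /=; rewrite face_inner //; lia.
Qed.

Lemma cup_face_mid n p q (x : C n.+1) : n = (p + q)%N ->
  tensor_map (face p.+1) (idm _) (cup p.+1 q x) =
  tensor_map (idm _) (face 0) (cup p q.+1 x).
Proof.
move=> en; rewrite (eq_tensor_map (f' := @last_face p) (g' := idm _)) //.
  by rewrite cup_last_first //; apply: eq_tensor_map.
exact: face_last.
Qed.

Lemma cup_face_sum n p q (x : C n.+1) :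
  cup p q (face_sum x) = tensor_map (@face_sum p) (idm _) (cup p.+1 q x) +
    (-1) ^+ p *: tensor_map (idm _) (@face_sum q) (cup p q.+1 x).
Proof.
have [en|en] := eqVneq n (p + q)%N; last first.
  by rewrite !cup_out ?linear0 ?scaler0 ?addr0 //; lia.
rewrite (tensor_map_suml (a := fun i : 'I_p.+2 => (-1) ^+ i)
  (F := fun i => @face p i : {linear C p.+1 -> C p}) (f := @face_sum p)) //.
rewrite (tensor_map_sumr (a := fun i : 'I_q.+2 => (-1) ^+ i)
  (G := fun i => @face q i : {linear C q.+1 -> C q}) _ (g := @face_sum q)) //.
(* Split off face [p.+1] of the left factor and face 0 of the right one: by [cup_face_mid] they give
   the same term, with signs (-1)^(p+1) and (-1)^p. *)
rewrite [X in _ + _ *: X]big_ord_recl big_ord_recr /= cup_face_mid // scalerDr expr0 scale1r.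
rewrite exprS mulN1r scaleNr addrA addrNK linear_sum /= scaler_sumr.
rewrite -(big_mkord xpredT (fun i => cup p q ((-1) ^+ i *: face i x))).
rewrite (big_cat_nat (n := p.+1)) /=; try lia.
congr (_ + _); last first.
  (* Beyond the first [p.+1] faces, number [i + p.+1] is face [i.+1] of the right factor, and (-1)^p
     splits off its sign. *)
  rewrite -{1}[p.+1]add0n big_addn big_mkord (_ : n.+2 - p.+1 = q.+1)%N; last by lia.
  apply: eq_bigr => i _; rewrite linearZ /= addnS addnC -addnS cup_face_right //.
    by rewrite exprD scalerA.
  exact: ltn_ord.
rewrite big_mkord; apply: eq_bigr => i _.
by rewrite linearZ /= cup_face_left // -ltnS.
Qed.

Lemma face_sum_sum n (x : C n.+2) : face_sum (face_sum x) = 0.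
Proof.
pose a i j := (-1) ^+ (i + j) *: face i (face j x).
have -> : face_sum (face_sum x) = \sum_(i < n.+2) \sum_(j < n.+3) a i j.
  apply: eq_bigr => i _; rewrite linear_sum scaler_sumr.
  by apply: eq_bigr => j _; rewrite linearZ scalerA -exprD.
(* Each row is cut into [j <= i] and [i < j]. The first part misses the top index and the second
   misses 0, so after a shift both run over the same square. Transposing the second part then pairs
   [a i j] with [a j i.+1], of opposite sign by [face_face]. *)
have split_row (i : 'I_n.+2) : \sum_(j < n.+3) a i j =
    \sum_(j < n.+2) (if (j <= i)%N then a i j else 0) +
    \sum_(j < n.+2) (if (i <= j)%N then a i j.+1 else 0).
  transitivity (\sum_(j < n.+3) (if (j <= i)%N then a i j else 0) +
      \sum_(j < n.+3) (if (i < j)%N then a i j else 0)).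
    rewrite -big_split; apply: eq_bigr => j _ /=.
    by case: leqP; rewrite ?addr0 ?add0r.
  by rewrite big_ord_recr [X in _ + X]big_ord_recl /= leqNgt ltn_ord addr0 add0r.
under eq_bigr do rewrite split_row.
rewrite big_split /= [X in _ + X]exchange_big -big_split big1 //= => i _.
rewrite -big_split big1 //= => j _; case: leqP => [ji|_]; last by rewrite addr0.
rewrite /a (@face_face _ j i.+1); last by rewrite ltnS ji; exact: ltn_ord.
by rewrite /= addnS addnC exprS mulN1r scaleNr addrN.
Qed.

(** * Passage from components to the direct sum *)

Lemma big_ord_single (V : nmodType) (b c : nat) (F : nat -> V) :
  (forall i, i != c -> F i = 0) -> ((b <= c)%N -> F c = 0) -> \sum_(i < b) F i = F c.
Proof.
move=> F0 Fc; have [bc|cb] := leqP b c.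
  rewrite Fc // big1 // => i _; apply: F0.
  by rewrite neq_ltn (leq_trans (ltn_ord i)).
by rewrite (bigD1 (Ordinal cb)) //= big1 ?addr0 // => i ic; apply: F0.
Qed.

Let incl n : {linear C n -> cooperad_total C} := @dsum_in k C n.

(* The boxed form avoids the dependent index [n - p] of the definition: the
   summands with [p + q != n] vanish. *)
Lemma cup_at_box b n (x : C n) : (n < b)%N ->
  cup_at x = \sum_(p < b) \sum_(q < b) tensor_map (incl p) (incl q) (cup p q x).
Proof.
move=> nb; pose F p q := tensor_map (incl p) (incl q) (cup p q x).
have F0 p q : n != (p + q)%N -> F p q = 0.
  by move=> npq; rewrite /F cup_out ?linear0.
have -> : cup_at x = \sum_(p < n.+1) F p (n - p)%N.
  rewrite /cup_at big_add1 big_mkord; apply: eq_bigr => p _.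
  congr (tensor_map _ _ _); rewrite /cup_summand /cup; exact: eq_tensor_map.
transitivity (\sum_(p < b) (if (p < n.+1)%N then F p (n - p)%N else 0)).
  by rewrite -big_mkcond /= -(big_ord_widen _ (fun p => F p (n - p)%N)).
apply: eq_bigr => p _; case: ltnP => pn.
  by apply/esym/(@big_ord_single _ b (n - p) (F p)) => [q qn|bnp]; apply: F0; lia.
by rewrite big1 // => q _; apply: F0; lia.
Qed.

Lemma linear_cup_at_box (V : lmodType k)
    (h : {linear cooperad_total C ⊗ cooperad_total C -> V}) b n (x : C n) : (n < b)%N ->
  h (cup_at x) = \sum_(p < b) \sum_(q < b) h (tensor_map (incl p) (incl q) (cup p q x)).
Proof.
move=> nb; rewrite (cup_at_box _ nb) linear_sum; apply: eq_bigr => p _.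
by rewrite linear_sum.
Qed.

(** * The dg coalgebra laws on the direct sum *)

Lemma cooperad_diff_sq (x : cooperad_total C) : cooperad_diff C (cooperad_diff C x) = 0.
Proof.
apply: (dsum_ext (f := cooperad_diff C \o cooperad_diff C) (g := \0)) => n y /=.
rewrite !diff_in; case: n y => [|[|n]] y.
- by rewrite diff_at0 !linear0.
- by rewrite [diff_at (diff_at y)]diff_at0 linear0.
- by rewrite (diff_atS y) [diff_at _]diff_atS face_sum_sum linear0.
Qed.

Lemma cup_counitl (x : cooperad_total C) :
  tensor_unitl (tensor_map (counit_bar C) (idm _) (cup_coproduct C x)) = x.
Proof.
rewrite -/(contractl _ _).
apply: (dsum_ext (f := @contractl _ _ _ (counit_bar C) \o cup_coproduct C) (g := idm _)) => n y /=.
pose G p q := contractl (counit_bar C) (tensor_map (incl p) (incl q) (cup p q y)).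
have G0 p q : n != (p + q)%N -> G p q = 0.
  by move=> npq; rewrite /G cup_out ?linear0.
have -> : contractl (counit_bar C) (cup_coproduct C (dsum_in y)) =
    \sum_(p < n.+1) \sum_(q < n.+1) G p q.
  by rewrite cup_in (@linear_cup_at_box _ _ n.+1).
(* The counit kills the rows of positive degree [p]; in row 0 only [q = n] survives. *)
rewrite big_ord_recl [X in _ + X]big1 => [|p _]; last first.
  rewrite big1 // => q _; rewrite /G contractl_map /contractl tensor_map0l ?linear0 // => z.
  exact: counit_bar_inS.
rewrite addr0 (@big_ord_single _ _ n (G 0%N)) => [|q qn|]; first last.
- by rewrite ltnn.
- by apply: G0; rewrite eq_sym.
rewrite /G contractl_map -[in RHS](ec_cupl y); congr (incl n _).
by apply: eq_contractl => z; apply: counit_bar_in0.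
Qed.

Lemma cup_counitr (x : cooperad_total C) :
  tensor_unitr (tensor_map (idm _) (counit_bar C) (cup_coproduct C x)) = x.
Proof.
rewrite -/(contractr _ _).
apply: (dsum_ext (f := @contractr _ _ _ (counit_bar C) \o cup_coproduct C) (g := idm _)) => n y /=.
pose G p q := contractr (counit_bar C) (tensor_map (incl p) (incl q) (cup p q y)).
have G0 p q : n != (p + q)%N -> G p q = 0.
  by move=> npq; rewrite /G cup_out ?linear0.
have -> : contractr (counit_bar C) (cup_coproduct C (dsum_in y)) =
    \sum_(q < n.+1) \sum_(p < n.+1) G p q.
  by rewrite cup_in (@linear_cup_at_box _ _ n.+1) // exchange_big.
rewrite big_ord_recl [X in _ + X]big1 => [|q _]; last first.
  rewrite big1 // => p _; rewrite /G contractr_map /contractr tensor_map0r ?linear0 // => z.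
  exact: counit_bar_inS.
rewrite addr0 (@big_ord_single _ _ n (G^~ 0%N)) => [|p pn|]; first last.
- by rewrite ltnn.
- by apply: G0; rewrite addn0 eq_sym.
rewrite /G contractr_map -[in RHS](ec_cupr y); congr (incl n _).
by apply: eq_contractr => z; apply: counit_bar_in0.
Qed.

Lemma cup_coproduct_coassoc (x : cooperad_total C) :
  tensor_assoc (tensor_map (cup_coproduct C) (idm _) (cup_coproduct C x)) =
  tensor_map (idm _) (cup_coproduct C) (cup_coproduct C x).
Proof.
apply: (dsum_ext
  (f := @tensor_assoc k _ _ _ \o tensor_map (cup_coproduct C) (idm _) \o cup_coproduct C)
  (g := tensor_map (idm _) (cup_coproduct C) \o cup_coproduct C)) => n y /=.
(* The intermediate arities [m] and [s] stay free: each term lives only at [m = p + q], respectively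
   [s = q + r], so these sums collapse at the end. *)
pose T m p q r := tensor_map (incl p) (tensor_map (incl q) (incl r))
  (tensor_assoc (tensor_map (@cup m p q) (idm _) (cup m r y))).
pose U s p q r := tensor_map (incl p) (tensor_map (incl q) (incl r))
  (tensor_map (idm _) (@cup s q r) (cup p s y)).
have T0 m p q r : m != (p + q)%N -> T m p q r = 0.
  move=> mpq; rewrite /T (tensor_map0l (f := @cup m p q)) ?linear0 // => z.
  exact: cup_out.
have U0 s p q r : s != (q + r)%N -> U s p q r = 0.
  move=> sqr; rewrite /U (tensor_map0r _ (g := @cup s q r)) ?linear0 // => z.
  exact: cup_out.
have TU p q r : T (p + q)%N p q r = U (q + r)%N p q r.
  rewrite /T /U; have [en|en] := eqVneq n (p + q + r)%N.
    by rewrite (@cup_coassoc _ _ (q + r)%N).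
  by rewrite !(cup_out (n := n)) ?linear0 //; lia.
(* The intermediate arity runs only up to [n]; a sum [p + q] outside that range must contribute zero
   for the collapse. *)
have Tbig p q r : (n < p + q)%N -> T (p + q)%N p q r = 0.
  by move=> npq; rewrite /T cup_out ?linear0 //; lia.
have Ubig p q r : (n < q + r)%N -> U (q + r)%N p q r = 0.
  by move=> nqr; rewrite /U cup_out ?linear0 //; lia.
(* One box of side [n.+1] serves every intermediate arity; the coefficients 1 fit the shape of
   [tensor_map_suml] and [tensor_map_sumr]. *)
pose D m (z : C m) := \sum_(pq : 'I_n.+1 * 'I_n.+1)
  1 *: (tensor_map (incl pq.1) (incl pq.2) \o @cup m pq.1 pq.2) z.
have cupE m (z : C m) : (m < n.+1)%N -> cup_coproduct C (dsum_in z) = D m z.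
  move=> mn; rewrite cup_in (cup_at_box _ mn) pair_bigA /=.
  by apply: eq_bigr => pq _; rewrite scale1r.
rewrite cup_in.
transitivity (\sum_(p < n.+1) \sum_(q < n.+1) \sum_(r < n.+1) T (p + q)%N p q r).
  transitivity (\sum_(m < n.+1) \sum_(r < n.+1) \sum_(p < n.+1) \sum_(q < n.+1) T m p q r).
    rewrite [LHS](@linear_cup_at_box _ (@tensor_assoc k _ _ _ \o
      tensor_map (cup_coproduct C) (idm _)) n.+1) //=.
    apply: eq_bigr => m _; apply: eq_bigr => r _.
    rewrite tensor_map_comp (tensor_map_suml (f := cup_coproduct C \o incl m) _ _
      (fun z => cupE m z (ltn_ord m))) linear_sum pair_bigA.
    apply: eq_bigr => pq _; rewrite scale1r /T /=.
    rewrite -tensor_assoc_map tensor_map_comp.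
    by congr tensor_assoc; apply: eq_tensor_map.
  rewrite exchange_big /=; under eq_bigr do rewrite exchange_big /=.
  rewrite exchange_big /=; apply: eq_bigr => p _.
  under eq_bigr do rewrite exchange_big /=.
  rewrite exchange_big /=; apply: eq_bigr => q _; apply: eq_bigr => r _.
  by apply: (big_ord_single (F := fun m => T m p q r)) => [m|]; [exact: T0 | exact: Tbig].
rewrite (@linear_cup_at_box _ (tensor_map (idm _) (cup_coproduct C)) n.+1) //=.
apply: eq_bigr => p _.
transitivity (\sum_(s < n.+1) \sum_(q < n.+1) \sum_(r < n.+1) U s p q r); last first.
  apply: eq_bigr => s _.
  rewrite tensor_map_comp (tensor_map_sumr _ (g := cup_coproduct C \o incl s) _
    (fun z => cupE s z (ltn_ord s))) pair_bigA.
  apply: eq_bigr => qr _; rewrite scale1r /U /=.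
  by rewrite !tensor_map_comp; apply: eq_tensor_map.
rewrite [RHS]exchange_big; apply: eq_bigr => q _.
rewrite [RHS]exchange_big; apply: eq_bigr => r _ /=.
rewrite TU; apply/esym/(big_ord_single (F := fun s => U s p q r)) => [s|].
  exact: U0.
exact: Ubig.
Qed.

(** The two swaps contribute (-1)^(pq + (q-1)p), which is (-1)^p. *)
Lemma koszul_diff p q (t : C p ⊗ C q) :
  koszul_swap (tensor_map (cooperad_diff C) (idm _)
    (koszul_swap (tensor_map (incl p) (incl q) t))) =
  (-1) ^+ p *: tensor_map (idm _) (cooperad_diff C) (tensor_map (incl p) (incl q) t).
Proof.
pose K := @koszul_swap k C.
apply: (tensor_ext (f := K \o tensor_map (cooperad_diff C) (idm _) \o K \o
    tensor_map (incl p) (incl q))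
  (g := (-1) ^+ p \*: (tensor_map (idm _) (cooperad_diff C) \o
    tensor_map (incl p) (incl q)))) => x y.
rewrite /K /= !tensor_map_pure koszul_swap_pure !linearZ /= !tensor_map_pure /=.
(* Degree [q = 0] is separate: the differential vanishes there, and the truncated predecessor of 0
   would give a wrong exponent. *)
clear t; case: q y => [|q] y.
  by rewrite !diff_in !diff_at0 !linear0 pure0l !linear0.
rewrite !diff_in koszul_swap_pure scalerA -exprD; congr (_ *: _).
by rewrite mulnS [(q * p)%N]mulnC -addnA addnn exprD -mul2n exprM sqrrN !expr1n mulr1.
Qed.

Lemma cup_diff (x : cooperad_total C) :
  cup_coproduct C (cooperad_diff C x) =
  tensor_map (cooperad_diff C) (idm _) (cup_coproduct C x) +
  koszul_swap (tensor_map (cooperad_diff C) (idm _) (koszul_swap (cup_coproduct C x))).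
Proof.
pose dl := tensor_map (cooperad_diff C) (idm (cooperad_total C)).
pose K := @koszul_swap k C.
apply: (dsum_ext (f := cup_coproduct C \o cooperad_diff C)
  (g := (dl \o cup_coproduct C) \+ (K \o dl \o K \o cup_coproduct C))) => n y.
rewrite /= diff_in !cup_in; case: n y => [|n] y.
  rewrite diff_at0 linear0 /K /dl !(@cup_at_box 1) // !big_ord_recl !big_ord0 !addr0.
  rewrite koszul_diff tensor_map_comp tensor_map0l ?tensor_map_comp ?tensor_map0r
    ?scaler0 ?addr0 //.
    by move=> z /=; rewrite diff_in diff_at0 linear0.
  by move=> z /=; rewrite diff_in diff_at0 linear0.
have dE m (z : C m.+1) : cooperad_diff C (dsum_in z) = incl m (face_sum z).
  by rewrite diff_in diff_atS.
have d0 (z : C 0) : cooperad_diff C (dsum_in z) = 0.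
  by rewrite diff_in diff_at0 linear0.
rewrite diff_atS (@cup_at_box n.+1) //.
rewrite -[RHS]/(dl (cup_at y) + K (dl (K (cup_at y)))).
(* In the box of side [n.+2], row [p = 0] vanishes since the differential is zero on [C 0], and for
   [p > 0] column [q = n.+1] has too large an arity. A shift of [p] leaves a box of side [n.+1]; the
   other term is treated with [p] and [q] exchanged. *)
have -> : dl (cup_at y) = \sum_(p < n.+1) \sum_(q < n.+1)
    tensor_map (incl p) (incl q) (tensor_map (@face_sum p) (idm _) (cup p.+1 q y)).
  rewrite [LHS](@linear_cup_at_box _ dl n.+2) // big_ord_recl big1 ?add0r => [|q _]; last first.
    by rewrite /dl /= tensor_map_comp tensor_map0l.
  apply: eq_bigr => p _; rewrite big_ord_recr /= cup_out ?linear0 ?addr0; last by rewrite /bump; lia.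
  apply: eq_bigr => q _; rewrite /dl !tensor_map_comp.
  by apply: eq_tensor_map => // z /=; apply: dE.
have -> : K (dl (K (cup_at y))) = \sum_(p < n.+1) \sum_(q < n.+1)
    tensor_map (incl p) (incl q)
      ((-1) ^+ p *: tensor_map (idm _) (@face_sum q) (cup p q.+1 y)).
  rewrite [LHS](@linear_cup_at_box _ (K \o dl \o K) n.+2) // exchange_big big_ord_recl /=.
  rewrite [X in X + _]big1 ?add0r => [|p _]; last first.
    by rewrite /K /dl /= koszul_diff tensor_map_comp tensor_map0r ?scaler0.
  rewrite [RHS]exchange_big; apply: eq_bigr => q _.
  rewrite big_ord_recr /= cup_out ?linear0 ?addr0; last by rewrite /bump; lia.
  apply: eq_bigr => p _; rewrite /K /dl koszul_diff linearZ /=; congr (_ *: _).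
  rewrite !tensor_map_comp.
  by apply: eq_tensor_map => // z /=; apply: dE.
rewrite -big_split; apply: eq_bigr => p _.
rewrite -big_split; apply: eq_bigr => q _ /=.
by rewrite -linearD cup_face_sum.
Qed.

End CooperadFaces.

Theorem proposition4p3 (k : comPzRingType) (C : cooperad_comul k) :
  [/\ (forall x : cooperad_total C, cooperad_diff C (cooperad_diff C x) = 0),
      (forall x : cooperad_total C,
         tensor_assoc (tensor_map (cup_coproduct C) (idm (cooperad_total C)) (cup_coproduct C x)) =
         tensor_map (idm (cooperad_total C)) (cup_coproduct C) (cup_coproduct C x)),
      (forall x : cooperad_total C,
         tensor_unitl (tensor_map (counit_bar C) (idm (cooperad_total C)) (cup_coproduct C x)) = x),
      (forall x : cooperad_total C,
         tensor_unitr (tensor_map (idm (cooperad_total C)) (counit_bar C) (cup_coproduct C x)) = x) &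
      (forall x : cooperad_total C,
         cup_coproduct C (cooperad_diff C x) =
         tensor_map (cooperad_diff C) (idm (cooperad_total C)) (cup_coproduct C x) +
         koszul_swap
           (tensor_map (cooperad_diff C) (idm (cooperad_total C)) (koszul_swap (cup_coproduct C x))))].
Proof.
split.
- exact: cooperad_diff_sq.
- exact: cup_coproduct_coassoc.
- exact: cup_counitl.
- exact: cup_counitr.
- exact: cup_diff.
Qed.
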